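(* Let $G$ be a graph and let $F:V(G)\to 2^{\mathbb N}$. If $|F(v)|\le\frac13\deg(v)-1$ for each $v\in V(G)$, then $G$ has an $F$-avoiding orientation.
   Context: Given $F:V(G)\to 2^{\mathbb N}$, an orientation $D$ of $G$ is $F$-avoiding if the out-degree $\deg^+_D(v)\notin F(v)$ for every $v\in V(G)$. *)

(* Defs.v *)
From mathcomp Require Import all_boot all_order all_algebra.
From mathcomp Require Import finmap.
From mathcomp Require Import boolp classical_sets cardinality.

Set Implicit Arguments.
Unset Strict Implicit.
Unset Printing Implicit Defensive.

(* A finite simple graph on V is a symmetric irreflexive relation e : rel V. *)

Definition degree (V : finType) (e : rel V) (v : V) : nat :=
  #|[set w : V | e v w]%SET|.

(* D u v means that the edge uv is directed from u to v. *)
Definition orientation (V : finType) (e D : rel V) : Prop :=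
  (forall u v : V, D u v -> e u v) /\
  (forall u v : V, e u v -> D u v (+) D v u).

Definition outdegree (V : finType) (D : rel V) (v : V) : nat :=
  #|[set w : V | D v w]%SET|.

Definition avoiding (V : finType) (F : V -> set nat) (D : rel V) : Prop :=
  forall v : V, ~ F v (outdegree D v).

(* Main.v *)
Require Import Defs.
From mathcomp Require Import all_boot all_order all_algebra.
From mathcomp Require Import finmap.
From mathcomp Require Import boolp classical_sets cardinality.
From mathcomp Require Import fintype finset zify ring lra.

Set Implicit Arguments.
Unset Strict Implicit.
Unset Printing Implicit Defensive.

Import Order.TTheory GRing.Theory Num.Theory.

Local Open Scope ring_scope.

(* Order the vertices and let A be the arcs from earlier to later vertices. With
   x_p = 1 if the arc p keeps its direction, the product over v and a in F v of
   (outdegree of v - a) must be nonzero somewhere on the cube {0,1}^A, for which it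
   is enough that its top homogeneous part, the product over v of
   (sum of x_p out of v - sum of x_p into v)^|F v|, is nonzero modulo the x_p^2.
   Multiply these factors in the order of the vertices. By the Lefschetz property
   of Q[x_1..x_b]/(x_i^2), the g-th power of x_1 + ... + x_b is injective on degree
   k if 2k + g <= b. So if M is a set of arcs, and v takes its phi arcs of M going
   out of v while k of the b arcs into v were already taken, then the product stays
   nonzero as soon as 2k + |F v| - phi <= b. If M contained exactly one third of the
   arcs into and out of v, this would read |F v| <= deg v / 3; the spare 1 in the
   hypothesis pays for rounding. *)

(** * The Lefschetz property of the squarefree algebra *)

(* A function psi on sets of arcs stands for the element sum_S psi S * x^S of
   R[x_h]/(x_h^2), and up B is multiplication by the sum of x_h over h in B. *)
Definition up (R : numDomainType) (E : finType) (B : {set E})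
    (psi : {set E} -> R) (S : {set E}) : R :=
  \sum_(h in S :&: B) psi (S :\ h).

(** For S avoiding both arcs, the coefficient of x_e x^S minus that of x_e' x^S. It vanishes for all
    pairs in B exactly when psi is symmetric in the variables of B. *)
Definition dswap (R : numDomainType) (E : finType) (e e' : E)
    (psi : {set E} -> R) (S : {set E}) : R :=
  if (e \in S) || (e' \in S) then 0 else psi (e |: S) - psi (e' |: S).

Lemma up0 (R : numDomainType) (E : finType) (B : {set E}) :
  up B (fun=> 0 : R) = fun=> 0.
Proof. by apply/funext => S; rewrite /up big1. Qed.

Lemma up_setU1 (R : numDomainType) (E : finType) (B : {set E}) (e : E)
    (psi : {set E} -> R) (S : {set E}) : e \in B -> e \notin S ->
  up B psi (e |: S) = psi S + \sum_(h in S :&: B) psi (e |: (S :\ h)).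
Proof.
move=> eB eS; rewrite /up (bigD1 e) /=; last by rewrite !inE eqxx eB.
rewrite setU1K //; congr (_ + _); apply: eq_big => [h|h].
  by rewrite !inE; case: (eqVneq h e) => [->|]; rewrite ?(negPf eS) ?andbF ?andbT.
rewrite !inE => /andP[_ he]; congr psi; apply/setP => x; rewrite !inE.
by case: (eqVneq x e) => [->|] //=; rewrite eq_sym he.
Qed.

(** At a set S avoiding e and e', the two terms that delete e and e' are both [psi S] and cancel. *)
Lemma up_dswap (R : numDomainType) (E : finType) (B : {set E}) (e e' : E)
    (psi : {set E} -> R) : e \in B -> e' \in B ->
  up (B :\ e :\ e') (dswap e e' psi) = dswap e e' (up B psi).
Proof.
move=> eB e'B; apply/funext => S; rewrite {2}/dswap.
case: ifPn => [eS|]; last first.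
  rewrite negb_or => /andP[eS e'S]; rewrite !up_setU1 // opprD addrACA subrr add0r.
  rewrite -sumrB /up; apply: eq_big => [h|h].
    rewrite !inE; case: (boolP (h \in S)) => //= hS.
    have -> : h != e by apply: contraNneq eS => <-.
    by have -> : h != e' by apply: contraNneq e'S => <-.
  by rewrite /dswap !inE (negPf eS) (negPf e'S) !andbF.
rewrite /up big1 // => h; rewrite !inE => /and4P[_ he' he _].
by rewrite /dswap !inE (eq_sym e) he (eq_sym e') he' /= eS.
Qed.

Lemma iter_up_dswap (R : numDomainType) (E : finType) (B : {set E}) (e e' : E)
    (psi : {set E} -> R) g : e \in B -> e' \in B ->
  iter g (up (B :\ e :\ e')) (dswap e e' psi) = dswap e e' (iter g (up B) psi).
Proof. by move=> eB e'B; elim: g => //= g ->; rewrite up_dswap. Qed.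

Lemma up_support (R : numDomainType) (E : finType) (B : {set E}) (psi : {set E} -> R) k :
  (forall S, #|S :&: B| != k -> psi S = 0) ->
  forall S, #|S :&: B| != k.+1 -> up B psi S = 0.
Proof.
move=> supp S SB; rewrite /up big1 // => h; rewrite inE => /andP[hS hB].
apply: supp; apply: contra SB => /eqP <-.
by rewrite (cardsD1 h (S :&: B)) !inE hS hB add1n eqSS setIDAC.
Qed.

(** The symmetric case. One factor is peeled off at a time, since [up B psi] is again symmetric in
    B, of degree k + 1. *)
Lemma iter_up_inj_dswap (R : numDomainType) (E : finType) (B : {set E}) g k
    (psi : {set E} -> R) :
  (forall e e', e \in B -> e' \in B -> e != e' -> dswap e e' psi = fun=> 0) ->
  (forall S, #|S :&: B| != k -> psi S = 0) -> (k + g <= #|B|)%N ->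
  iter g (up B) psi = (fun=> 0) -> psi = fun=> 0.
Proof.
elim: g k psi => [|g IHg] k psi inv supp kgB //; rewrite iterSr => itup.
have {IHg itup} up_psi : up B psi = fun=> 0.
  apply: (IHg k.+1) itup; [|exact: up_support|lia].
  by move=> e e' eB e'B ee'; rewrite -up_dswap // inv // up0.
apply/funext => S; case: (eqVneq #|S :&: B| k) => [Sk|]; last exact: supp.
have [h hB hS] : exists2 h, h \in B & h \notin S.
  have /subsetPn[h hB hS] : ~~ (B \subset S :&: B).
    by apply/negP => /subset_leq_card; lia.
  by exists h => //; apply: contra hS; rewrite inE hB andbT.
have := congr1 (fun F => F (h |: S)) up_psi; rewrite /= up_setU1 //.
(* By symmetry each of the k + 1 deletions from [h |: S] yields [psi S], so (k + 1) psi S = 0. *)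
rewrite (eq_bigr (fun=> psi S)); last first.
  move=> h'; rewrite inE => /andP[h'S h'B].
  have hh' : h != h' by apply: contraNneq hS => ->.
  have := congr1 (fun F => F (S :\ h')) (inv _ _ hB h'B hh').
  rewrite /dswap !inE eqxx (negPf hS) andbF /= setD1K //.
  by move=> /eqP; rewrite subr_eq0 => /eqP.
rewrite sumr_const Sk -mulrS => /eqP; rewrite mulrn_eq0 /= => /eqP; exact.
Qed.

(* Hard Lefschetz for Q[x_h]/(x_h^2), h in B. The swap differences dswap e e' psi
   have degree k - 1 in the variables B minus e, e', so by induction they vanish;
   then psi is symmetric in B and the claim is a computation of binomials. *)
Lemma iter_up_inj (R : numDomainType) (E : finType) (B : {set E}) g k
    (psi : {set E} -> R) :
  (forall S, #|S :&: B| != k -> psi S = 0) -> (k.*2 + g <= #|B|)%N ->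
  iter g (up B) psi = (fun=> 0) -> psi = fun=> 0.
Proof.
elim: k B psi => [|k IHk] B psi supp kgB itup.
  apply: (iter_up_inj_dswap (k := 0)) itup => // e e' eB e'B _.
  apply/funext => S; rewrite /dswap !supp ?subrr ?if_same //.
    by rewrite cards_eq0; apply/set0Pn; exists e'; rewrite !inE eqxx.
  by rewrite cards_eq0; apply/set0Pn; exists e; rewrite !inE eqxx.
apply: (iter_up_inj_dswap _ supp _ itup); last by lia.
move=> e e' eB e'B ee'; apply: (IHk (B :\ e :\ e')).
- move=> S; rewrite /dswap; case: ifPn => // /norP[eS e'S] Sk.
  have SB : S :&: (B :\ e :\ e') = S :&: B.
    apply/setP => x; rewrite !inE; case: (boolP (x \in S)) => //= xS.
    have -> : x != e by apply: contraNneq eS => <-.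
    by have -> : x != e' by apply: contraNneq e'S => <-.
  have cU x : x \in B -> x \notin S -> #|(x |: S) :&: B| = #|S :&: B|.+1.
    move=> xB xS; rewrite setIUl (setIidPl _) ?sub1set //.
    by rewrite cardsU1 !inE (negPf xS).
  by rewrite !supp ?subrr // cU // eqSS -SB.
(* B loses two elements while the degree drops by one, which preserves 2k + g <= |B|. *)
- have := cardsD1 e B; have := cardsD1 e' (B :\ e).
  by rewrite !inE eq_sym ee' eB e'B /=; lia.
- rewrite iter_up_dswap // itup; apply/funext => S.
  by rewrite /dswap subrr if_same.
Qed.

(** * Powers of the linear form of one vertex *)

Definition updown (R : numDomainType) (E : finType) (F B : {set E})
    (psi : {set E} -> R) (S : {set E}) : R := up F psi S - up B psi S.

(** Binomial expansion: psi is free of F, and as x_h^2 = 0 the |T|-th power of the F-sum contains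
    x^T with coefficient |T|!. Times the binomial coefficient this is [j ^_ #|T|]. *)
Lemma iter_updown (R : numDomainType) (E : finType) (F B : {set E})
    (psi : {set E} -> R) j (T S : {set E}) :
  [disjoint F & B] -> (forall S : {set E}, ~~ [disjoint S & F] -> psi S = 0) ->
  T \subset F -> [disjoint S & F] ->
  iter j (updown F B) psi (T :|: S) =
  (j ^_ #|T|)%:R * (-1) ^+ (j - #|T|) * iter (j - #|T|) (up B) psi S.
Proof.
move=> dFB supp; elim: j T S => [|j IHj] T S TF SF.
  rewrite sub0n /= expr0 mulr1; case: (set_0Vmem T) => [->|[x xT]].
    by rewrite cards0 set0U mul1r.
  have T_gt0 : (0 < #|T|)%N by rewrite card_gt0; apply/set0Pn; exists x.
  rewrite supp ?ffact_small ?mul0r //; apply/pred0Pn; exists x.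
  by rewrite /= inE xT (subsetP TF).
have xSF x : x \in S -> x \in F = false by move=> /(disjointFr SF).
rewrite iterS /updown {1}/up.
have -> : (T :|: S) :&: F = T.
  apply/setP => x; rewrite !inE; case: (boolP (x \in T)) => [/(subsetP TF) ->|_] //=.
  by case: (boolP (x \in S)) => //= /xSF.
rewrite (eq_bigr (fun=> (j ^_ #|T|.-1)%:R * (-1) ^+ (j - #|T|.-1) *
  iter (j - #|T|.-1) (up B) psi S)); last first.
  move=> h hT; have hF := subsetP TF h hT.
  have -> : (T :|: S) :\ h = (T :\ h) :|: S.
    rewrite setDUl; congr (_ :|: _); apply/setDidPl.
    by rewrite disjoint_sym disjoints1 (contraL (fun hS => negbT (xSF h hS))).
  rewrite IHj //; last by apply: subset_trans TF; exact: subD1set.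
  by rewrite (cardsD1 h T) hT.
rewrite sumr_const.
have -> : up B (iter j (updown F B) psi) (T :|: S) =
    (j ^_ #|T|)%:R * (-1) ^+ (j - #|T|) * iter (j - #|T|).+1 (up B) psi S.
  rewrite iterS /up mulr_sumr.
  have -> : (T :|: S) :&: B = S :&: B.
    apply/setP => x; rewrite !inE; case: (boolP (x \in T)) => //= /(subsetP TF) xF.
    by rewrite (disjointFr dFB xF) andbF.
  apply: eq_bigr => h; rewrite inE => /andP[hS hB].
  have -> : (T :|: S) :\ h = T :|: (S :\ h).
    rewrite setDUl; congr (_ :|: _); apply/setDidPl.
    rewrite disjoint_sym disjoints1; apply/negP => /(subsetP TF).
    by rewrite xSF.
  by rewrite IHj //; apply: disjointWl SF; exact: subD1set.
case: #|T| => [|t] /=.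
  by rewrite mulr0n sub0r !ffactn0 !mul1r ?subn0 exprS mulN1r mulNr.
(* With |T| = t + 1: all terms vanish for j < t, only the first survives for j = t, and for j > t
   the recursion of falling factorials combines both. *)
have [tj|jt] := ltnP j t.
  have ff0 a b : (a < b)%N -> (a ^_ b)%:R = 0 :> R by move=> /ffact_small ->.
  by rewrite !ff0 ?mul0r ?mul0rn ?subrr // leqW.
rewrite subSS; case: (ltnP t j) => [tj|tj]; last first.
  have -> : t = j by lia.
  rewrite (@ffact_small j j.+1) // !mul0r subr0 subnn expr0 !mulr1 ffactSS.
  by rewrite -[LHS]mulr_natl natrM mulrA.
have -> : (j - t = (j - t.+1).+1)%N by lia.
rewrite -mulr_natl ffactSS ffactnSr !natrM exprS iterS.
have -> : (j - t)%:R = j%:R - t%:R :> R by rewrite natrB // ltnW.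
by rewrite -!natr1; ring.
Qed.

Lemma up_neq0 (R : numDomainType) (E : finType) (B : {set E})
    (psi : {set E} -> R) S :
  up B psi S != 0 -> exists2 h, h \in S :&: B & psi (S :\ h) != 0.
Proof.
move=> upS; apply/exists_inP; apply: contraR upS; rewrite negb_exists_in => /forall_inP psi0.
by rewrite /up big1 // => h /psi0; rewrite negbK => /eqP.
Qed.

Lemma updown_neq0 (R : numDomainType) (E : finType) (F B : {set E})
    (psi : {set E} -> R) S :
  updown F B psi S != 0 -> exists2 h, h \in S :&: (F :|: B) & psi (S :\ h) != 0.
Proof.
rewrite /updown => upS.
have [upF|] := eqVneq (up F psi S) 0; last first.
  by case/up_neq0 => h /setIP[hS hF] psih; exists h; rewrite // !inE hS hF.
move: upS; rewrite upF sub0r oppr_eq0 => /up_neq0[h /setIP[hS hB] psih].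
by exists h; rewrite // !inE hS hB orbT.
Qed.

Lemma iter_updown_subset (R : numDomainType) (E : finType) (F B Q : {set E})
    (psi : {set E} -> R) j :
  F :|: B \subset Q -> (forall S, psi S != 0 -> S \subset Q) ->
  forall S, iter j (updown F B) psi S != 0 -> S \subset Q.
Proof.
move=> FBQ suppQ; elim: j => [|j IHj] S /=; first exact: suppQ.
case/updown_neq0 => h.
rewrite inE => /andP[hS hFB] /IHj; rewrite subDset => /subset_trans; apply.
by rewrite subUset subxx sub1set (subsetP FBQ).
Qed.

Lemma iter_updown_card (R : numDomainType) (E : finType) (F B : {set E})
    (psi : {set E} -> R) m j :
  (forall S, psi S != 0 -> #|S| = m) ->
  forall S, iter j (updown F B) psi S != 0 -> #|S| = (m + j)%N.
Proof.
move=> psim; elim: j => [|j IHj] S /=; first by rewrite addn0; exact: psim.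
case/updown_neq0 => h; rewrite inE => /andP[hS _] /IHj.
by move=> Sh; rewrite (cardsD1 h S) hS Sh addnS.
Qed.

(** The [c i] cut out graded components that [up B] shifts by one, so Lefschetz can be applied to a
    single component. *)
Lemma iter_up_restrict (R : numDomainType) (E : finType) (B : {set E})
    (c : nat -> pred {set E}) (psi : {set E} -> R) g :
  (forall i S h, h \in S :&: B -> c i.+1 S = c i (S :\ h)) ->
  iter g (up B) (fun S => if c 0%N S then psi S else 0) =
  fun S => if c g S then iter g (up B) psi S else 0.
Proof.
move=> cS; elim: g => [|g IHg] //=; rewrite IHg; apply/funext => S; rewrite /up.
case: ifPn => cgS.
  by apply: eq_bigr => h /cS <-; rewrite cgS.
by apply: big1 => h /cS <-; rewrite (negPf cgS).
Qed.

(** * Nonvanishing of the top homogeneous part *)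

Lemma subset_of_card (E : finType) (A : {set E}) n : (n <= #|A|)%N ->
  exists2 T : {set E}, T \subset A & #|T| = n.
Proof.
move=> nA; exists [set x in take n (enum A)].
  by apply/subsetP => x; rewrite inE => /mem_take; rewrite mem_enum.
rewrite cardsE; have /card_uniqP -> : uniq (take n (enum A)) by rewrite take_uniq ?enum_uniq.
by rewrite size_take -cardE; case: ltngtP nA.
Qed.

Definition arcs_out (V : finType) (A : {set V * V}) (v : V) : {set V * V} :=
  [set p in A | p.1 == v].
Definition arcs_in (V : finType) (A : {set V * V}) (v : V) : {set V * V} :=
  [set p in A | p.2 == v].

(* The product over v in s of (sum_(arcs out) x - sum_(arcs in) x)^(f v), i.e. the
   top homogeneous part of the product of the polynomials outdeg_v - a. *)
Fixpoint topcoef (V : finType) (A : {set V * V}) (f : V -> nat) (s : seq V)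
    : {set V * V} -> rat :=
  if s is v :: s' then
    iter (f v) (updown (arcs_out A v) (arcs_in A v)) (topcoef A f s')
  else fun S => (S == set0)%:R.

(* The list starts with the last vertex of the topological order. *)
Definition rev_topological (V : finType) (A : {set V * V}) (s : seq V) : Prop :=
  forall p, p \in A -> p.2 \in s -> (p.1 \in s) && (index p.2 s < index p.1 s)%N.

Lemma rev_topological_cons (V : finType) (A : {set V * V}) (v : V) (s : seq V) :
  v \notin s -> rev_topological A (v :: s) ->
  rev_topological A s /\ (forall p, p \in A -> p.2 = v -> p.1 \in s).
Proof.
move=> vs topo; split=> p pA p2.
  have := topo p pA; rewrite !inE p2 orbT /= => /(_ isT).
  have -> : v == p.2 = false by apply: contraNF vs => /eqP ->.
  rewrite [v == p.1]eq_sym; by case: eqP.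
have := topo p pA; rewrite p2 mem_head => /(_ isT)/andP[].
by rewrite inE /= eqxx [v == p.1]eq_sym; case: eqP.
Qed.

Lemma topcoef_subset (V : finType) (A : {set V * V}) (f : V -> nat) (s : seq V) :
  uniq s -> rev_topological A s ->
  forall S, topcoef A f s S != 0 -> S \subset [set p | p.1 \in s].
Proof.
elim: s => [_ _ S|v s IHs] /=.
  by case: (eqVneq S set0) => [->|]; rewrite ?sub0set ?eqxx.
case/andP => vs us topo; have [topos inv] := rev_topological_cons vs topo.
apply: iter_updown_subset.
  apply/subsetP => p; rewrite !inE => /orP[] /andP[pA /eqP pv]; first by rewrite pv eqxx.
  by rewrite inv ?orbT.
move=> S /(IHs us topos)/subsetP sub; apply/subsetP => p /sub.
by rewrite !inE => ->; rewrite orbT.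
Qed.

Lemma topcoef_card (V : finType) (A : {set V * V}) (f : V -> nat) (s : seq V) :
  forall S, topcoef A f s S != 0 -> #|S| = (\sum_(v <- s) f v)%N.
Proof.
elim: s => [S|v s IHs] /=.
  by rewrite big_nil; case: (eqVneq S set0) => [->|]; rewrite ?cards0 ?eqxx.
by rewrite big_cons addnC; apply: iter_updown_card.
Qed.

(* When v is processed, the component of the product in which v takes exactly a
   set T of arcs out of v is a nonzero multiple of x^T times the (f v - |T|)-th
   power of the sum over the arcs into v. Only the number of arcs into w already
   taken is tracked for an unprocessed w, since Lefschetz needs no more. *)
Lemma topcoef_neq0 (V : finType) (A M : {set V * V}) (f : V -> nat) (s : seq V) :
  uniq s -> rev_topological A s -> M \subset A -> {in A, forall p, p.1 != p.2} ->
  (forall v, f v + (#|M :&: arcs_in A v|).*2 <= #|M :&: arcs_out A v| + #|arcs_in A v|)%N ->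
  exists2 S, topcoef A f s S != 0 &
    forall w, w \notin s ->
      (#|S :&: arcs_in A w| <= #|M :&: arcs_in A w :&: [set p | p.1 \in s]|)%N.
Proof.
move=> + + MA irr Mf; elim: s => [_ _|v s IHs].
  by exists set0 => /= [|w _]; rewrite ?eqxx ?oner_eq0 // set0I cards0.
rewrite [uniq _]/= => /andP[vs us] topo.
have [topos inv] := rev_topological_cons vs topo.
have {IHs} [S PS0 SM] := IHs us topos.
set P := topcoef A f s in PS0; set F := arcs_out A v; set B := arcs_in A v.
(* T takes as many arcs of M out of v as the [f v] factors allow; the remaining g factors use arcs
   into v. *)
have [T TMF Tcard] := subset_of_card (geq_minr (f v) #|M :&: F|).
set g := (f v - #|T|)%N.
(* The component with i further arcs into v and unchanged counts at the unprocessed vertices. *)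
pose c i (R : {set V * V}) := (#|R :&: B| == #|S :&: B| + i)%N &&
  [forall (w | w \notin v :: s), #|R :&: arcs_in A w| == #|S :&: arcs_in A w|].
have cS i (R : {set V * V}) h : h \in R :&: B -> c i.+1 R = c i (R :\ h).
  rewrite inE => /andP[hR hB]; congr (_ && _).
    by rewrite (cardsD1 h) inE hR hB add1n addnS eqSS setIDAC.
  apply: eq_forallb_in => w wvs; rewrite setIDAC (cardsD1 h (R :&: _)).
  suff -> : h \in R :&: arcs_in A w = false by [].
  move: hB; rewrite !inE => /andP[_ /eqP ->].
  by case: eqP wvs => [->|]; rewrite ?inE ?eqxx ?andbF.
have [S0 cgS0 PS00] : exists2 S0, c g S0 & iter g (up B) P S0 != 0.
  (* For g = 0 the set S serves. Otherwise T is all of [M :&: F], and the hypothesis at v gives the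
     Lefschetz bound 2 |S :&: B| + g <= |B|. *)
  have [g0|g_gt0] := posnP g.
    exists S; rewrite ?g0 // /c addn0 eqxx /=; exact/forall_inP.
  pose psi R := if c 0%N R then P R else 0.
  have psiS : psi S != 0.
    by rewrite /psi /c addn0 eqxx /=; case: ifP => // /negP[]; apply/forall_inP.
  have : iter g (up B) psi <> (fun=> 0).
    move=> /(iter_up_inj (k := #|S :&: B|)) psi0; move: psiS; rewrite psi0 ?eqxx //.
      by move=> R RB; rewrite /psi /c addn0 (negPf RB).
    have := SM v vs; have := Mf v; rewrite -/B -/F.
    have : (#|M :&: B :&: [set p | p.1 \in s]| <= #|M :&: B|)%N.
      by apply: subset_leq_card; exact: subsetIl.
    by move: g_gt0; rewrite /g Tcard; lia.
  rewrite (iter_up_restrict P g cS) => up_neq.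
  have [S0 S0P] : exists S0, (if c g S0 then iter g (up B) P S0 else 0) != 0.
    apply: contrapT => noS; apply: up_neq; apply/funext => S0.
    by apply: contrapT => /eqP S0P; apply: noS; exists S0.
  by move: S0P; case: ifP => [cgS0|]; rewrite ?eqxx //; exists S0.
have Ps R : P R != 0 -> R \subset [set p | p.1 \in s] by apply: topcoef_subset.
have dF (R : {set V * V}) : R \subset [set p : V * V | p.1 \in s] -> [disjoint R & F].
  move=> /subsetP Rs; apply/pred0P => p /=; apply/negP => /andP[/Rs].
  by rewrite !inE => ps /andP[_ /eqP pv]; move: vs; rewrite -pv ps.
have S0s : S0 \subset [set p | p.1 \in s].
  move: PS00; have : B \subset [set p | p.1 \in s].
    by apply/subsetP => p; rewrite !inE => /andP[pA /eqP]; apply: inv.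
  elim: (g) (S0) => [|g' IH] S1 Bs /=; first exact: Ps.
  case/up_neq0 => h; rewrite inE => /andP[_ hB] /(IH _ Bs).
  by rewrite subDset => /subset_trans; apply; rewrite subUset subxx sub1set (subsetP Bs).
exists (T :|: S0) => [|w].
  rewrite [topcoef _ _ _]/= iter_updown ?dF //.
  - rewrite !mulf_neq0 // ?signr_eq0 // pnatr_eq0 -lt0n ffact_gt0 Tcard geq_minl //.
  - apply/pred0P => p /=; rewrite !inE; apply/negP => /andP[/andP[pA /eqP p1] /andP[_ /eqP p2]].
    by have := irr _ pA; rewrite p1 p2 eqxx.
  - by move=> R; apply: contraNeq => /Ps /dF.
  - by apply: subset_trans TMF _; exact: subsetIr.
move=> wvs; have ws : w \notin s by apply: contra wvs; rewrite inE orbC => ->.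
move: cgS0 => /andP[_ /forall_inP/(_ w wvs)/eqP S0w].
(* Arcs in X start in s and those of T start at v, so the two counts add up. *)
set X := M :&: arcs_in A w :&: [set p | p.1 \in s].
have dX : X :&: (T :&: arcs_in A w) = set0.
  apply/setP => p; rewrite !inE; apply/negP => /andP[/andP[_ ps]].
  move=> /andP[/(subsetP TMF)]; rewrite !inE => /and3P[_ _ /eqP pv].
  by move: vs; rewrite -pv ps.
have : (#|X :|: (T :&: arcs_in A w)| <= #|M :&: arcs_in A w :&: [set p | p.1 \in v :: s]|)%N.
  apply/subset_leq_card/subsetP => p; rewrite !inE => /orP[].
    by move=> /andP[-> ->]; rewrite orbT.
  move=> /andP[/(subsetP TMF)]; rewrite !inE => /and3P[-> _ ->].
  by move=> /andP[-> ->].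
rewrite cardsU dX cards0 subn0; apply: leq_trans.
rewrite setIUl cardsU S0w addnC (leq_trans (leq_subr _ _)) // leq_add2r.
exact: SM.
Qed.

(** * Choosing the arcs M by iterated rounding *)

(** The coefficient matrix has rank below |T|, so its left kernel has a nonzero vector, extended by
    0 outside T. *)
Lemma exists_kernel (K : fieldType) (P V : finType) (T : {set P}) (D : {set V})
    (c : V -> P -> K) : (#|D| < #|T|)%N ->
  exists y : P -> K, [/\ forall p, p \notin T -> y p = 0,
    exists2 p, p \in T & y p != 0 &
    forall v, v \in D -> \sum_p c v p * y p = 0].
Proof.
move=> DT; pose A := \matrix_(i < #|T|, j < #|D|) c (enum_val j) (enum_val i).
have kA : kermx A != 0.
  rewrite -mxrank_eq0 mxrank_ker -lt0n subn_gt0.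
  exact: leq_ltn_trans (rank_leq_col A) DT.
have /rowV0Pn[u /sub_kermxP uA /rV0Pn[k uk]] := kA.
pose y p := if boolP (p \in T) is AltTrue pT then u 0 (enum_rank_in pT p) else 0.
have yE k' : y (enum_val k') = u 0 k'.
  rewrite /y; case: {-}_ / boolP => [pT|]; last by rewrite enum_valP.
  by rewrite enum_valK_in.
have y0 p : p \notin T -> y p = 0.
  by move=> pT; rewrite /y; case: {-}_ / boolP => // pT'; rewrite pT' in pT.
exists y; split=> //; first by exists (enum_val k); rewrite ?enum_valP // yE.
move=> v vD; rewrite (bigID (mem T)) /= [X in _ + X]big1 ?addr0; last first.
  by move=> p /y0 ->; rewrite mulr0.
rewrite big_enum_val /=.
have := congr1 (fun B : 'M_(_, _) => B 0 (enum_rank_in vD v)) uA.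
rewrite !mxE => uA0; rewrite -[RHS]uA0; apply: eq_bigr => j _.
by rewrite yE !mxE enum_rankK_in // mulrC.
Qed.

Definition fractional (P : finType) (x : P -> rat) : {set P} :=
  [set p | (0 < x p) && (x p < 1)].

Lemma exists_boundary_step (P : finType) (x y : P -> rat) :
  (forall p, 0 <= x p <= 1) -> (forall p, p \notin fractional x -> y p = 0) ->
  (exists2 p, p \in fractional x & y p != 0) ->
  exists2 t : rat, (forall p, 0 <= x p + t * y p <= 1) &
    exists2 p, p \in fractional x & p \notin fractional (fun p => x p + t * y p).
Proof.
move=> x01 yfrac [p0 p0x yp0].
(* Ratio test: [r p] is the step at which coordinate p reaches 1 or 0, and the smallest one is
   taken. *)
pose r p := if 0 < y p then (1 - x p) / y p else x p / (- y p).
have [p /andP[px yp] pmin] := @arg_minP _ _ _ p0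
  (fun p => (p \in fractional x) && (y p != 0)) r (introT andP (conj p0x yp0)).
exists (r p).
  move=> q; have [qx|/yfrac ->] := boolP (q \in fractional x); last by rewrite mulr0 addr0.
  have [->|yq] := eqVneq (y q) 0; first by rewrite mulr0 addr0.
  have := pmin q; rewrite qx yq => /(_ isT) rpq.
  have rp_ge0 : 0 <= r p.
    rewrite /r; have /andP[xp0 xp1] := x01 p; case: ifPn => yp_gt0.
      by rewrite divr_ge0 ?subr_ge0 // ltW.
    by rewrite divr_ge0 // oppr_ge0 leNgt.
  move: qx; rewrite inE => /andP[xq0 xq1].
  have /orP[yq_lt0|yq_gt0] : (y q < 0) || (0 < y q) by rewrite -neq_lt.
    have : r p * (- y q) <= x q.
      by rewrite -ler_pdivlMr ?oppr_gt0 //; move: rpq; rewrite {2}/r ltNge (ltW yq_lt0).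
    have : 0 <= r p * (- y q) by rewrite mulr_ge0 // oppr_ge0 ltW.
    lra.
  have : r p * y q <= 1 - x q.
    by rewrite -ler_pdivlMr //; move: rpq; rewrite {2}/r yq_gt0.
  have := mulr_ge0 rp_ge0 (ltW yq_gt0); lra.
exists p => //; rewrite inE /r; case: ifPn => yp_gt0.
  by rewrite divfK // addrC subrK ltxx andbF.
by rewrite invrN mulrN mulNr divfK // subrr ltxx.
Qed.

(* If x is the indicator of M then this is, up to the constant for x = 1/3, the
   quantity |M out| - 2 |M in| that topcoef_neq0 needs to be large. *)
Definition arc_weight (V : finType) (A : {set V * V}) (x : V * V -> rat) (v : V) : rat :=
  \sum_(p in arcs_out A v) (x p - 1 / 3) - 2 * \sum_(p in arcs_in A v) (x p - 1 / 3).

(* Smallest weight reachable by rounding x: fractional arcs out of v go to 0 and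
   fractional arcs into v go to 1. *)
Definition worst_weight (V : finType) (A : {set V * V}) (x : V * V -> rat) (v : V) : rat :=
  \sum_(p in arcs_out A v) ((x p == 1)%:R - 1 / 3)
  - 2 * \sum_(p in arcs_in A v) ((x p != 0)%:R - 1 / 3).

(** Fractional arcs are already counted at their worst, so moving them cannot lower the value. *)
Lemma worst_weight_le (V : finType) (A : {set V * V}) (x x' : V * V -> rat) (v : V) :
  (forall p, p \notin fractional x -> x' p = x p) ->
  worst_weight A x v <= worst_weight A x' v.
Proof.
move=> xx'; rewrite /worst_weight.
have le1 : \sum_(p in arcs_out A v) ((x p == 1)%:R - 1 / 3 : rat) <=
    \sum_(p in arcs_out A v) ((x' p == 1)%:R - 1 / 3).
  apply: ler_sum => p _; rewrite lerD2r ler_nat.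
  case: (eqVneq (x p) 1) => // xp1; rewrite xx' ?xp1 ?eqxx //.
  by rewrite inE xp1 ltxx andbF.
have le2 : \sum_(p in arcs_in A v) ((x' p != 0)%:R - 1 / 3 : rat) <=
    \sum_(p in arcs_in A v) ((x p != 0)%:R - 1 / 3).
  apply: ler_sum => p _; rewrite lerD2r ler_nat.
  case: (eqVneq (x p) 0) => [xp0|_]; last by case: eqP.
  by rewrite xx' ?xp0 ?eqxx // inE xp0 ltxx.
lra.
Qed.

Lemma sum_gap_lt (P : finType) (T X : {set P}) (h : P -> rat) :
  (forall p, p \in X -> p \notin T -> h p = 0) ->
  (forall p, p \in T -> h p < 1) ->
  \sum_(p in X) h p <= #|X :&: T|%:R ?= iff (X :&: T == set0).
Proof.
move=> h0 h1; rewrite (bigID (mem T)) /= [X in _ + X]big1 ?addr0; last first.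
  by move=> p /andP[]; exact: h0.
rewrite -sum1_card natr_sum; under eq_bigl do rewrite -in_setI.
split.
  by apply: ler_sum => p; rewrite inE => /andP[_ /h1/ltW].
apply/idP/eqP => [|->]; last by rewrite !big_set0 eqxx.
move/eqP => eqs; apply/setP => q; rewrite in_set0; apply/negP => qXT.
have : \sum_(p in X :&: T) h p < \sum_(p in X :&: T) 1.
  apply: ltr_sum; first by apply/hasP; exists q; rewrite ?mem_index_enum.
  by move=> p; rewrite inE => /andP[_ /h1].
by rewrite eqs ltxx.
Qed.

Lemma fractionalPn (P : finType) (x : P -> rat) p :
  0 <= x p <= 1 -> p \notin fractional x -> x p = 0 \/ x p = 1.
Proof.
rewrite inE => /andP[]; rewrite !le_eqVlt => /orP[/eqP<-|->]; first by left.
by move=> /orP[/eqP->|->]; right.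
Qed.

Lemma sum_fractional_out (V : finType) (A : {set V * V}) (v : V) (x : V * V -> rat) :
  (forall p, 0 <= x p <= 1) ->
  \sum_(p in arcs_out A v) (x p - (x p == 1)%:R) <=
  #|arcs_out A v :&: fractional x|%:R ?= iff (arcs_out A v :&: fractional x == set0).
Proof.
move=> x01; apply: sum_gap_lt => p.
  by move=> _ /(fractionalPn (x01 p))[] ->; rewrite ?eqxx ?subrr // eq_sym oner_eq0 subr0.
by rewrite inE => /andP[_ xp1]; rewrite (lt_eqF xp1) subr0.
Qed.

Lemma sum_fractional_in (V : finType) (A : {set V * V}) (v : V) (x : V * V -> rat) :
  (forall p, 0 <= x p <= 1) ->
  \sum_(p in arcs_in A v) ((x p != 0)%:R - x p) <=
  #|arcs_in A v :&: fractional x|%:R ?= iff (arcs_in A v :&: fractional x == set0).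
Proof.
move=> x01; apply: sum_gap_lt => p.
  by move=> _ /(fractionalPn (x01 p))[] ->; rewrite ?eqxx ?subrr // oner_eq0 subrr.
by rewrite inE => /andP[xp0 _]; rewrite (gt_eqF xp0) /=; lra.
Qed.

(** The two weights differ by at least 2. Each fractional arc contributes less than 1 to the
    difference if it leaves v and less than 2 if it enters v, hence the strict bound. *)
Lemma fractional_lt_gap (V : finType) (A : {set V * V}) (x : V * V -> rat) (v : V) :
  (forall p, 0 <= x p <= 1) -> 0 <= arc_weight A x v -> worst_weight A x v <= - 2 ->
  (2 < #|arcs_out A v :&: fractional x| + (#|arcs_in A v :&: fractional x|).*2)%N.
Proof.
move=> x01 w0 l2.
have [le1 eq1] := sum_fractional_out A v x01.
have [le2 eq2] := sum_fractional_in A v x01.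
set a := #|_ :&: _| in le1 *; set b := #|_ :&: _| in le2 *.
have gap : arc_weight A x v - worst_weight A x v =
   \sum_(p in arcs_out A v) (x p - (x p == 1)%:R) +
   2 * \sum_(p in arcs_in A v) ((x p != 0)%:R - x p).
  rewrite /arc_weight /worst_weight !sumrB; ring.
have ab : (2 <= a + b.*2)%N.
  by rewrite -(ler_nat rat) natrD -muln2 natrM; lra.
rewrite ltn_neqAle ab andbT; apply/eqP => eq_ab.
have : (2 : rat) = a%:R + 2 * b%:R by rewrite -natrM mul2n -natrD -eq_ab.
move=> eqr.
have e1 : \sum_(p in arcs_out A v) (x p - (x p == 1)%:R) = a%:R by lra.
have e2 : \sum_(p in arcs_in A v) ((x p != 0)%:R - x p) = b%:R by lra.
move: eq1 eq2; rewrite e1 e2 !eqxx => /esym; rewrite -cards_eq0 -/a => /eqP a0.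
by move=> /esym; rewrite -cards_eq0 -/b => /eqP b0; move: eq_ab; rewrite a0 b0.
Qed.

Lemma sum_card_arcs (V : finType) (A T : {set V * V}) : T \subset A ->
  (\sum_v (#|arcs_out A v :&: T| + #|arcs_in A v :&: T|))%N = (#|T|).*2.
Proof.
move=> /subsetP TA; rewrite big_split -addnn /=; congr addn.
  rewrite -sum1_card (partition_big fst predT) //=; apply: eq_bigr => v _.
  rewrite -sum1_card; apply: eq_bigl => p; rewrite !inE andbC.
  by case: (boolP (p \in T)) => // /TA ->.
rewrite -sum1_card (partition_big snd predT) //=; apply: eq_bigr => v _.
rewrite -sum1_card; apply: eq_bigl => p; rewrite !inE andbC.
by case: (boolP (p \in T)) => // /TA ->.
Qed.

(** Let a and b count the fractional arcs out of and into v. For v in D, a + 2b > 2 gives a + b >=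
    2, and counting arc ends over D forces equality. So rounding down loses less than 2 on arcs out
    of v and only helps on arcs into v. *)
Lemma round_down (V : finType) (A : {set V * V}) (x : V * V -> rat) :
  (forall p, 0 <= x p <= 1) -> (forall p, p \notin A -> x p = 0) ->
  (forall v, 0 <= arc_weight A x v \/ - 2 < worst_weight A x v) ->
  (#|fractional x| <= #|[set v | (worst_weight A x v <= - 2)%R]|)%N ->
  exists2 M : {set V * V}, M \subset A &
    forall v, - 2 < arc_weight A (fun p => (p \in M)%:R) v.
Proof.
move=> x01 x0 inv; set D := [set v | _] => TD.
have TA : fractional x \subset A.
  by apply/subsetP => p; rewrite inE; apply: contraTT => /x0 ->; rewrite ltxx.
pose a v := #|arcs_out A v :&: fractional x|; pose b v := #|arcs_in A v :&: fractional x|.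
have ab2 v : v \in D -> (2 <= a v + b v)%N.
  rewrite inE => vD; have /(fractional_lt_gap x01)/(_ vD) : 0 <= arc_weight A x v.
    by case: (inv v) => //; rewrite ltNge vD.
  by rewrite -/(a v) -/(b v); lia.
have a2 v : v \in D -> (a v <= 2)%N.
  move=> vD; suff : (a v + b v - 2 == 0)%N by lia.
  suff : (\sum_(u in D) (a u + b u - 2) == 0)%N.
    by rewrite sum_nat_eq0 => /forall_inP/(_ v vD).
  have : (\sum_(u in D) (a u + b u) <= #|fractional x|.*2)%N.
    by rewrite -(sum_card_arcs TA) [leqRHS](bigID (mem D)) leq_addr.
  rewrite (eq_bigr (fun u => (a u + b u - 2) + 2)%N); last by move=> u /ab2; lia.
  rewrite big_split sum_nat_const muln2 /= => le; rewrite -leqn0 -(leq_add2r #|D|.*2).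
  by apply: leq_trans le _; rewrite leq_double.
exists [set p | x p == 1].
  apply/subsetP => p; rewrite inE; apply: contraTT => /x0 ->.
  by rewrite eq_sym oner_eq0.
move=> v; have [vD|vD] := boolP (v \in D).
  have W0 : 0 <= arc_weight A x v.
    by move: vD; rewrite inE leNgt => /negP; case: (inv v).
  have le_in : \sum_(p in arcs_in A v) ((p \in [set p | x p == 1])%:R - 1 / 3 : rat) <=
      \sum_(p in arcs_in A v) (x p - 1 / 3).
    apply: ler_sum => p _; rewrite lerD2r inE.
    by have /andP[xp0 _] := x01 p; case: eqP => [->|].
  have eq_out : \sum_(p in arcs_out A v) ((p \in [set p | x p == 1])%:R - 1 / 3 : rat) =
      \sum_(p in arcs_out A v) (x p - 1 / 3) - \sum_(p in arcs_out A v) (x p - (x p == 1)%:R).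
    by rewrite -sumrB; apply: eq_bigr => p _; rewrite inE; ring.
  have [le_gap eq_gap] := sum_fractional_out A v x01.
  have gap2 : \sum_(p in arcs_out A v) (x p - (x p == 1)%:R) < 2.
    move: le_gap; rewrite le_eqVlt eq_gap -/(a v) => /orP[/eqP a0|lt_a].
      by move: eq_gap; rewrite a0 eqxx cards0 => /eqP ->.
    apply: lt_le_trans lt_a _.
    by rewrite ler_nat a2.
  rewrite /arc_weight in W0 *; lra.
apply: lt_le_trans (_ : worst_weight A x v <= _); first by rewrite ltNge; move: vD; rewrite inE.
rewrite /worst_weight /arc_weight.
have eq_out : \sum_(p in arcs_out A v) ((p \in [set p | x p == 1])%:R - 1 / 3 : rat) =
    \sum_(p in arcs_out A v) ((x p == 1)%:R - 1 / 3).
  by apply: eq_bigr => p _; rewrite inE.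
have le_in : \sum_(p in arcs_in A v) ((p \in [set p | x p == 1])%:R - 1 / 3 : rat) <=
    \sum_(p in arcs_in A v) ((x p != 0)%:R - 1 / 3).
  apply: ler_sum => p _; rewrite lerD2r inE ler_nat.
  by case: eqP => // ->; rewrite oner_eq0.
lra.
Qed.

(* Iterated rounding from x = 1/3, where all weights are 0. While fewer vertices
   have worst weight <= -2 than there are fractional arcs, some move preserves the
   weights of these vertices and makes an arc integral. Otherwise each of these
   vertices meets exactly two fractional arcs and all arcs can be rounded down. *)
Lemma exists_balanced_arcs (V : finType) (A : {set V * V}) :
  exists2 M : {set V * V}, M \subset A &
    forall v, - 2 < arc_weight A (fun p => (p \in M)%:R) v.
Proof.
suff round n (x : V * V -> rat) :
    (#|fractional x| <= n)%N -> (forall p, 0 <= x p <= 1) ->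
    (forall p, p \notin A -> x p = 0) ->
    (forall v, 0 <= arc_weight A x v \/ - 2 < worst_weight A x v) ->
    exists2 M : {set V * V}, M \subset A &
      forall v, - 2 < arc_weight A (fun p => (p \in M)%:R) v.
  apply: (round _ (fun p => if p \in A then 1 / 3 else 0) (leqnn _)).
  - by move=> p; case: ifP.
  - by move=> p /negPf ->.
  - move=> v; left; rewrite /arc_weight !big1 ?mulr0 ?subr0 // => p.
      by rewrite inE => /andP[-> _]; rewrite subrr.
    by rewrite inE => /andP[-> _]; rewrite subrr.
elim: n x => [|n IHn] x Tn x01 x0 inv.
  by apply: (round_down x01 x0 inv); apply: leq_trans Tn _.
pose T := fractional x; pose D := [set v | worst_weight A x v <= - 2].
have TA : T \subset A.
  apply/subsetP => p; rewrite inE; apply: contraTT => /x0 ->.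
  by rewrite ltxx.
have wD v : v \in D -> 0 <= arc_weight A x v.
  by rewrite inE leNgt => /negP low; case: (inv v).
have [DT|TD] := ltnP #|D| #|T|.
  (* For p in A this is the coefficient of [x p] in the weight of v, so moving along y fixes the
     weights on D. *)
  pose c v (p : V * V) : rat := (p.1 == v)%:R - 2 * (p.2 == v)%:R.
  have [y [yT ynz yD]] := exists_kernel c DT.
  have [t x'01 [q qT qT']] := exists_boundary_step x01 yT ynz.
  pose x' p := x p + t * y p.
  have xx' p : p \notin fractional x -> x' p = x p.
    by move=> /yT yp; rewrite /x' yp mulr0 addr0.
  apply: (IHn x') => //.
  - rewrite -ltnS; apply: leq_trans Tn; apply: proper_card; apply/properP; split.
      apply/subsetP => p; apply: contraTT => pT; rewrite inE xx' //.
      by move: pT; rewrite inE.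
    by exists q.
  - move=> p pA; rewrite xx' ?x0 //; apply: contra pA; exact: (subsetP TA).
  - move=> v; have [vD|vD] := boolP (v \in D).
      left; rewrite (_ : arc_weight A x' v = arc_weight A x v) ?wD //.
      have yA p : p \notin A -> y p = 0.
        by move=> pA; apply: yT; apply: contra pA; exact: (subsetP TA).
      have := yD v vD.
      under eq_bigr do rewrite /c mulrBl -mulrA.
      rewrite sumrB -mulr_sumr.
      have sumA (B : pred (V * V)) : \sum_p (B p)%:R * y p = \sum_(p in A | B p) y p.
        rewrite [RHS]big_mkcondr [RHS]big_mkcond /=; apply: eq_bigr => p _.
        case: (boolP (p \in A)) => [_|/yA ->]; last by rewrite mulr0.
        by case: (B p); rewrite ?mul1r ?mul0r.
      rewrite !sumA => yv0.
      have -> : arc_weight A x' v = arc_weight A x v +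
          t * (\sum_(p in A | p.1 == v) y p - 2 * \sum_(p in A | p.2 == v) y p).
        rewrite /arc_weight /x'.
        have sumX (X : {set V * V}) : \sum_(p in X) (x p + t * y p - 1 / 3) =
            \sum_(p in X) (x p - 1 / 3) + t * \sum_(p in X) y p.
          by rewrite mulr_sumr -big_split; apply: eq_bigr => p _ /=; rewrite addrAC.
        rewrite !sumX.
        have -> : \sum_(p in arcs_out A v) y p = \sum_(p in A | p.1 == v) y p.
          by apply: eq_bigl => p; rewrite inE.
        have -> : \sum_(p in arcs_in A v) y p = \sum_(p in A | p.2 == v) y p.
          by apply: eq_bigl => p; rewrite inE.
        ring.
      by rewrite yv0 mulr0 addr0.
    right; apply: lt_le_trans (worst_weight_le _ _ xx').
    by rewrite ltNge; move: vD; rewrite inE.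
exact: (round_down x01 x0 inv).
Qed.

(** * Polynomials on the cube and out-degrees *)

(** The value of sum_S psi S x^S at the indicator vector of w. *)
Definition multilinear_eval (R : numDomainType) (E : finType)
    (psi : {set E} -> R) (w : {set E}) : R := \sum_(S : {set E} | S \subset w) psi S.

Lemma multilinear_eval_inj (R : numDomainType) (E : finType) (psi : {set E} -> R) :
  (forall w, multilinear_eval psi w = 0) -> forall S, psi S = 0.
Proof.
move=> ev0 S; have [n] := ubnP #|S|; elim: n S => // n IHn S Sn.
have := ev0 S; rewrite /multilinear_eval (bigD1 S) //= big1 ?addr0 // => T /andP[TS TnS].
by apply: IHn; apply: leq_trans (proper_card _) Sn; rewrite properEneq TnS.
Qed.

(** On the cube x_h^2 is x_h rather than 0, so each h in [S :&: B] also returns x^S; this is the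
    diagonal term. *)
Lemma multilinear_eval_up (R : numDomainType) (E : finType) (B : {set E})
    (psi : {set E} -> R) (w : {set E}) :
  multilinear_eval (fun S => up B psi S + #|S :&: B|%:R * psi S) w =
  #|w :&: B|%:R * multilinear_eval psi w.
Proof.
rewrite /multilinear_eval.
transitivity (\sum_(h in w :&: B) \sum_(S : {set E} | (S \subset w) && (h \in S))
    (psi (S :\ h) + psi S)).
  rewrite (exchange_big_dep (fun S : {set E} => S \subset w)) /=; last by move=> ? ? _ /andP[].
  apply: eq_bigr => S Sw.
  transitivity (\sum_(h in S :&: B) (psi (S :\ h) + psi S)).
    by rewrite big_split sumr_const mulr_natl.
  apply: eq_bigl => h; rewrite !inE Sw /=.
  by case: (boolP (h \in S)) => hS; rewrite ?andbF // (subsetP Sw h hS) andbT.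
rewrite mulr_natl -sumr_const; apply: eq_bigr => h; rewrite inE => /andP[hw hB].
rewrite [RHS](bigID (fun S : {set E} => h \in S)) big_split /= addrC; congr (_ + _).
rewrite [RHS](reindex_onto (fun S => S :\ h) (fun S => h |: S)) /=; last first.
  by move=> S /andP[_ hS]; rewrite setU1K.
apply: eq_bigl => S; rewrite !inE eqxx /= andbT subDset -/(h |: w).
have -> : h |: w = w by apply/setUidPr; rewrite sub1set.
congr (_ && _); apply/idP/eqP => [hS|<-]; first by rewrite setD1K.
by rewrite setU11.
Qed.

(* w is the set of arcs of A that keep their direction; the others are reversed. *)
Definition outdeg_in (V : finType) (A w : {set V * V}) (v : V) : nat :=
  #|w :&: arcs_out A v| + #|arcs_in A v :\: w|.

(** Multiplication on the cube by outdegree - a, the outdegree being the sum of x over arcs out of v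
    plus the sum of 1 - x over arcs into v. *)
Definition mul_outdeg (V : finType) (A : {set V * V}) (v : V) (a : nat)
    (psi : {set V * V} -> rat) (S : {set V * V}) : rat :=
  updown (arcs_out A v) (arcs_in A v) psi S +
  (#|S :&: arcs_out A v|%:R - #|S :&: arcs_in A v|%:R + #|arcs_in A v|%:R - a%:R) * psi S.

Lemma multilinear_eval_mul_outdeg (V : finType) (A : {set V * V}) (v : V) (a : nat)
    (psi : {set V * V} -> rat) (w : {set V * V}) :
  multilinear_eval (mul_outdeg A v a psi) w =
  ((outdeg_in A w v)%:R - a%:R) * multilinear_eval psi w.
Proof.
have evout := multilinear_eval_up (arcs_out A v) psi w.
have evin := multilinear_eval_up (arcs_in A v) psi w.
have -> : multilinear_eval (mul_outdeg A v a psi) w =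
    multilinear_eval (fun S => up (arcs_out A v) psi S + #|S :&: arcs_out A v|%:R * psi S) w -
    multilinear_eval (fun S => up (arcs_in A v) psi S + #|S :&: arcs_in A v|%:R * psi S) w +
    (#|arcs_in A v|%:R - a%:R) * multilinear_eval psi w.
  rewrite /multilinear_eval -sumrB mulr_sumr -big_split; apply: eq_bigr => S _ /=.
  by rewrite /mul_outdeg /updown; ring.
rewrite evout evin /outdeg_in natrD.
have -> : #|arcs_in A v|%:R = #|w :&: arcs_in A v|%:R + #|arcs_in A v :\: w|%:R :> rat.
  by rewrite -natrD setIC cardsID.
ring.
Qed.

Fixpoint outdeg_poly (V : finType) (A : {set V * V}) (L : V -> seq nat) (s : seq V)
    : {set V * V} -> rat :=
  if s is v :: s' then foldr (mul_outdeg A v) (outdeg_poly A L s') (L v)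
  else fun S => (S == set0)%:R.

Lemma multilinear_eval_outdeg_poly (V : finType) (A : {set V * V}) (L : V -> seq nat)
    (s : seq V) (w : {set V * V}) :
  multilinear_eval (outdeg_poly A L s) w =
  \prod_(v <- s) \prod_(a <- L v) ((outdeg_in A w v)%:R - a%:R).
Proof.
elim: s => [|v s IHs].
  rewrite big_nil /multilinear_eval (bigD1 set0) ?sub0set //= eqxx big1 ?addr0 // => S.
  by case/andP => _ /negPf ->.
rewrite big_cons -IHs /=; elim: (L v) => [|a l IHl]; first by rewrite big_nil mul1r.
by rewrite big_cons -mulrA -IHl /= multilinear_eval_mul_outdeg.
Qed.

(** Each factor raises the degree only through its [updown] part, so its other terms never reach
    degree m. *)
Lemma outdeg_poly_top (V : finType) (A : {set V * V}) (L : V -> seq nat) (s : seq V) :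
  let m := (\sum_(v <- s) size (L v))%N in
  (forall S : {set V * V}, (m < #|S|)%N -> outdeg_poly A L s S = 0) /\
  (forall S : {set V * V}, #|S| = m -> outdeg_poly A L s S = topcoef A (fun v => size (L v)) s S).
Proof.
elim: s => [|v s IHs] /=.
  rewrite big_nil; split=> // S; rewrite card_gt0.
  by move=> /negPf ->.
rewrite big_cons addnC; elim: (L v) => [|a l [IHgt IHeq]]; first by rewrite addn0.
rewrite /= addnS.
have card_le (S : {set V * V}) h : (#|S| <= #|S :\ h|.+1)%N.
  by rewrite (cardsD1 h S); case: (h \in S).
split=> S Sm; rewrite /mul_outdeg IHgt ?mulr0 ?addr0; try by lia.
  rewrite /updown /up !big1 ?subrr // => h _; apply: IHgt;
    by rewrite -ltnS; apply: leq_trans Sm (card_le S h).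
by rewrite /updown /up; congr (_ - _); apply: eq_bigr => h;
  rewrite inE => /andP[hS _]; apply: IHeq; move: Sm; rewrite (cardsD1 h S) hS => -[].
Qed.

(** * From the arcs M to an avoiding orientation *)

Lemma arc_weight_indicator (V : finType) (A M : {set V * V}) (v : V) :
  arc_weight A (fun p => (p \in M)%:R) v =
  #|M :&: arcs_out A v|%:R - 2 * #|M :&: arcs_in A v|%:R
  - (#|arcs_out A v|%:R - 2 * #|arcs_in A v|%:R) / 3.
Proof.
have sumM (X : {set V * V}) :
    \sum_(p in X) ((p \in M)%:R - 1 / 3) = #|M :&: X|%:R - #|X|%:R / 3 :> rat.
  rewrite sumrB sumr_const -mulr_natl -natr_sum -big_mkcondr /= sum1_card.
  congr (_%:R - _); last by field.
  by apply: eq_card => p; rewrite !inE andbC.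
by rewrite /arc_weight !sumM; ring.
Qed.

(** A contains each edge in one direction only, so no w is counted twice. Used for the degree with X
    = Y = A, and for the out-degree with the kept and the reversed arcs. *)
Lemma card_arc_ends (V : finType) (A X Y : {set V * V}) (v : V) :
  (forall p, p \in A -> (p.2, p.1) \notin A) -> X \subset A -> Y \subset A ->
  #|[set w | ((v, w) \in X) || ((w, v) \in Y)]%SET| =
  (#|[set p in X | p.1 == v]%SET| + #|[set p in Y | p.2 == v]%SET|)%N.
Proof.
move=> asym /subsetP XA /subsetP YA.
have -> : [set p in X | p.1 == v]%SET = pair v @: [set w | (v, w) \in X]%SET.
  apply/setP => -[u w]; rewrite !inE /=; apply/andP/imsetP.
    by move=> [uwX /eqP uv]; exists w; rewrite ?inE -?uv.
  by move=> [w' + [-> ->]]; rewrite inE.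
have -> : [set p in Y | p.2 == v]%SET = (fun w => (w, v)) @: [set w | (w, v) \in Y]%SET.
  apply/setP => -[u w]; rewrite !inE /=; apply/andP/imsetP.
    by move=> [uwX /eqP uv]; exists u; rewrite ?inE -?uv.
  by move=> [w' + [-> ->]]; rewrite inE.
rewrite !card_imset; [|by move=> ? ? []|by move=> ? ? []].
rewrite -cardsUI [X in (_ + X)%N](_ : _ = 0)%N ?addn0.
  by apply: eq_card => w; rewrite !inE.
apply/eqP; rewrite cards_eq0; apply/eqP/setP => w; rewrite !inE.
by apply/negP => /andP[/XA/asym /= + /YA]; move=> /negP.
Qed.

(** If every w failed, the product would vanish on the whole cube, and with it the top coefficient
    that [topcoef_neq0] shows to be nonzero. *)
Lemma outdeg_in_avoiding (V : finType) (A M : {set V * V}) (L : V -> seq nat) :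
  rev_topological A (enum V) -> M \subset A -> {in A, forall p, p.1 != p.2} ->
  (forall v, size (L v) + (#|M :&: arcs_in A v|).*2 <=
    #|M :&: arcs_out A v| + #|arcs_in A v|)%N ->
  exists w, forall v, outdeg_in A w v \notin L v.
Proof.
move=> topo MA irr ML.
have [S PS _] := topcoef_neq0 (enum_uniq V) topo MA irr ML.
have [_ /(_ S (topcoef_card PS))] := outdeg_poly_top A L (enum V).
move=> top; apply: contrapT => none; move: PS; rewrite -top.
rewrite (_ : outdeg_poly A L (enum V) S = 0) ?eqxx //.
apply: multilinear_eval_inj => w; apply/eqP; rewrite multilinear_eval_outdeg_poly.
apply: contrapT => /negP; rewrite prodf_seq_neq0 => /allP nz; apply: none; exists w => v.
have := nz v (mem_enum V v); rewrite prodf_seq_neq0 /= => /allP nzv.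
by apply/negP => /nzv /=; rewrite subrr eqxx.
Qed.

Theorem theorem9 (V : finType) (e : rel V) (F : V -> set nat)
  (e_sym : symmetric e) (e_irr : irreflexive e)
  (F_small : forall v : V,
     finite_set (F v) /\
     (#|` fset_set (F v)|%:R <= 1 / 3 * (degree e v)%:R - 1 :> rat)%R) :
  exists D : rel V, orientation e D /\ avoiding F D.
Proof.
pose ix v := index v (enum V).
(* Edges point to the endpoint of smaller index, so [enum V] starts with the last vertex. *)
pose A : {set V * V} := [set p | e p.1 p.2 && (ix p.2 < ix p.1)%N]%SET.
have asym p : p \in A -> (p.2, p.1) \notin A.
  by rewrite !inE /= => /andP[_ lt]; rewrite negb_and -leqNgt (ltnW lt) orbT.
have topo : rev_topological A (enum V).
  by move=> p; rewrite inE => /andP[_ lt] _; rewrite mem_enum.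
have irr : {in A, forall p, p.1 != p.2}.
  by move=> p; rewrite inE => /andP[ep _]; apply: contraTneq ep => ->; rewrite e_irr.
have eA u v : e u v = ((u, v) \in A) || ((v, u) \in A).
  rewrite !inE /= (e_sym v u) -andb_orr; case: (boolP (e u v)) => //= euv.
  rewrite -neq_ltn; apply/esym; apply: contraTneq euv => ixuv.
  have ixK x : nth u (enum V) (ix x) = x by rewrite nth_index ?mem_enum.
  by rewrite -[u]ixK -[v]ixK ixuv e_irr.
have deg v : degree e v = (#|arcs_out A v| + #|arcs_in A v|)%N.
  rewrite -(card_arc_ends v asym (subxx A) (subxx A)).
  by apply: eq_card => w; rewrite inE [RHS]inE eA.
have [M MA Mw] := exists_balanced_arcs A.
pose L v := enum_fset (fset_set (F v)).
have ML v : (size (L v) + (#|M :&: arcs_in A v|).*2 <=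
    #|M :&: arcs_out A v| + #|arcs_in A v|)%N.
  have [_] := F_small v; have := Mw v; rewrite arc_weight_indicator deg natrD.
  rewrite -[#|` _|]/(size (L v)).
  set f := size _; set k := #|M :&: arcs_in A v|; set q := #|M :&: _|.
  set b := #|arcs_in A v|; set a := #|arcs_out A v| => lt le.
  (* The weight bound -2 and the spare 1, multiplied by 3, leave a slack of less than 3, which
     integrality removes. *)
  have : (6 * k + 3 * f < 3 * q + 3 * b + 3)%N.
    by rewrite -(ltr_nat rat) !natrD; lra.
  lia.
have [w avoid] := outdeg_in_avoiding topo MA irr ML.
exists (fun u v => ((u, v) \in w :&: A) || ((v, u) \in A :\: w)); split.
  split=> u v; rewrite eA !inE.
    by move=> /orP[] /andP[_ ->]; rewrite ?orbT.
  have := asym (u, v); rewrite !inE /=.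
  case: (boolP (e u v && _)) => [_ /(_ isT)/negPf ->|_ _] /=.
    by rewrite !andbF !andbT orbF; case: ((u, v) \in w).
  by move=> ->; rewrite !andbF !andbT; case: ((v, u) \in w).
move=> v Fv; have [Ffin _] := F_small v.
move: (avoid v) => /negP; apply; rewrite (in_fset_set Ffin); apply/mem_set.
suff <- : outdegree (fun u v => ((u, v) \in w :&: A) || ((v, u) \in A :\: w)) v =
    outdeg_in A w v by [].
rewrite /outdegree (card_arc_ends v asym (subsetIr _ _) (subsetDl _ _)) /outdeg_in.
by congr (_ + _)%N; apply: eq_card => p; rewrite !inE ?andbA.
Qed.
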